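(* Let $U,V\in\mathcal{Q}_2$ be unitaries such that $(U,V)\in\mathcal{S}_{\mathcal{Q}_2}$, and let $\lambda_{(U,V)}$ be the endomorphism of $\mathcal{Q}_2$ determined by $(U,V)$. Then an endomorphism $\lambda\in\operatorname{End}(\mathcal{Q}_2)$ satisfies $\lambda(u)=U$ if and only if $\lambda=\lambda_{(U,XV)}$ for some unitary $X\in C^*(U)'\cap\mathcal{Q}_2$.
   Context: The 2-adic ring $C^*$-algebra $\mathcal{Q}_2$ is the universal unital $C^*$-algebra generated by a unitary $u$ and an isometry $s_2$ with $s_2u=u^2s_2$ and $s_2s_2^*+us_2s_2^*u^*=1$. Put $s_1:=us_2$. $\operatorname{End}(\mathcal{Q}_2)$ is the set of unital $*$-endomorphisms of $\mathcal{Q}_2$, and $\mathcal{U}(A)$ denotes the unitary group of a unital $C^*$-algebra $A$. For $U\in\mathcal{U}(\mathcal{Q}_2)$ put $W_U:=s_1s_2^*+s_2Us_1^*$ (a unitary), and let $\mathcal{S}_{\mathcal{Q}_2}$ be the set of pairs $(U,V)\in\mathcal{U}(\mathcal{Q}_2)\times\mathcal{U}(\mathcal{Q}_2)$ with $UV=VW_U$. Each $(U,V)\in\mathcal{S}_{\mathcal{Q}_2}$ determines the unique endomorphism $\lambda_{(U,V)}\in\operatorname{End}(\mathcal{Q}_2)$ with $u\mapsto U$, $s_i\mapsto Vs_i$ ($i=1,2$), and every endomorphism of $\mathcal{Q}_2$ arises from exactly one such pair. $C^*(U)'\cap\mathcal{Q}_2$ is the relative commutant in $\mathcal{Q}_2$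 of the $C^*$-algebra generated by $U$. *)

(* Defs.v *)
From HB Require Import structures.
From mathcomp Require Import all_boot all_order all_algebra.
From mathcomp Require Import complex.
From mathcomp Require Import boolp classical_sets reals topology normedtype.

Set Implicit Arguments.
Unset Strict Implicit.
Unset Printing Implicit Defensive.

Import Order.TTheory GRing.Theory Num.Theory.
Import numFieldNormedType.Exports.

Local Open Scope classical_set_scope.
Local Open Scope ring_scope.

Definition norm_cvg (R : realType) (A : zmodType) (N : A -> R)
    (a : nat -> A) (l : A) : Prop :=
  N (a n - l) @[n --> \oo] --> (0 : R).

Definition norm_cauchy (R : realType) (A : zmodType) (N : A -> R)
    (a : nat -> A) : Prop :=
  forall e : R, 0 < e -> exists n0 : nat,
    forall m n, (n0 <= m)%N -> (n0 <= n)%N -> N (a m - a n) < e.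

(* Unital C*-algebras over R[i]; algType already imposes 1 != 0.  The norm is a
   separate R-valued field because a structure joining algType and
   normedModType would conflict with their existing join, numDomainType. *)
HB.mixin Record isCStarAlgebra (R : realType) A of GRing.Algebra R[i] A := {
  star : A -> A;
  cnorm : A -> R;
  starK : involutive star;
  starD : {morph star : x y / x + y};
  starZ : forall (a : R[i]) x, star (a *: x) = a^* *: star x;
  starM : forall x y, star (x * y) = star y * star x;
  cnorm_ge0 : forall x, 0 <= cnorm x;
  cnorm0_eq0 : forall x, cnorm x = 0 -> x = 0;
  cnormD : forall x y, cnorm (x + y) <= cnorm x + cnorm y;
  cnormZ : forall (a : R[i]) x, cnorm (a *: x) = Normc.normc a * cnorm x;
  cnormM : forall x y, cnorm (x * y) <= cnorm x * cnorm y;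
  cnorm_star : forall x, cnorm (star x * x) = cnorm x ^+ 2;
  cnorm_complete : forall a : nat -> A,
    norm_cauchy cnorm a -> exists l, norm_cvg cnorm a l
}.

#[short(type="cstarAlgType")]
HB.structure Definition CStarAlgebra (R : realType) :=
  {A of isCStarAlgebra R A & GRing.Algebra R[i] A}.

Notation "x ^†" := (star x) (at level 1, format "x ^†") : ring_scope.

HB.mixin Record isStarPreserving (R : realType) (A B : cstarAlgType R)
    (f : A -> B) := { star_hom : {morph f : x / x^†} }.

#[short(type="starHom")]
HB.structure Definition StarHom (R : realType) (A B : cstarAlgType R) :=
  {f of isStarPreserving R A B f & @GRing.LRMorphism R[i] A B *:%R f}.

Section CStar.
Context {R : realType} {A : cstarAlgType R}.

Definition unitary : set A := [set v | v^† * v = 1 /\ v * v^† = 1].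

Definition isometry : set A := [set v | v^† * v = 1].

Definition norm_closed (B : set A) : Prop :=
  forall (a : nat -> A) (l : A),
    (forall n, B (a n)) -> norm_cvg cnorm a l -> B l.

Definition cstar_subalgebra (B : set A) : Prop :=
  [/\ B 0 /\ (forall x y, B x -> B y -> B (x + y)),
      forall (a : R[i]) x, B x -> B (a *: x),
      forall x y, B x -> B y -> B (x * y),
      forall x, B x -> B x^† &
      norm_closed B].

Definition cstar_generated (S : set A) : set A :=
  [set x | forall B, cstar_subalgebra B -> S `<=` B -> B x].

Definition commutant (S : set A) : set A :=
  [set x | forall y, S y -> x * y = y * x].

Definition Q2_relations (u s : A) : Prop :=
  [/\ unitary u, isometry s, s * u = u ^+ 2 * s &
      s * s^† + u * s * s^† * u^† = 1].

Lemma cnorm0 : cnorm (0 : A) = 0.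
Proof.
by have := cnormZ 0 (0 : A); rewrite scale0r ComplexField.Normc.normc0 mul0r.
Qed.

Lemma star0 : (0 : A)^† = 0.
Proof. by apply: (@addrI _ (0 : A)^†); rewrite -starD !addr0. Qed.

Lemma Q2_relations_orth (u s : A) : Q2_relations u s -> s^† * (u * s) = 0.
Proof.
move=> [_ ss _ sum1]; set b := s^† * (u * s).
have bb : b * b^† = 0.
  have /(congr1 (fun z => s^† * z * s)) := sum1.
  rewrite mulrDr mulrDl mulr1 !mulrA ss mul1r ss.
  rewrite -[X in _ = X]addr0 => /addrI <-.
  by rewrite /b !starM starK !mulrA.
have := cnorm_star b^†; rewrite starK bb cnorm0 => /esym/eqP.
rewrite sqrf_eq0 => /eqP/cnorm0_eq0 b0.
by rewrite -[LHS]starK -/b b0 star0.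
Qed.

End CStar.

(* The 2-adic ring C*-algebra with its canonical generators, specified up to
   isomorphism by its universal property.  The uniqueness part of
   q2_universal also follows from q2_gen by continuity of *-homomorphisms. *)
Record Q2Alg (R : realType) := MkQ2Alg {
  q2_alg :> cstarAlgType R;
  q2_u : q2_alg;
  q2_s2 : q2_alg;
  q2_rel : Q2_relations q2_u q2_s2;
  q2_gen : cstar_generated [set q2_u; q2_s2] = setT;
  q2_universal : forall (B : cstarAlgType R) (v t : B), Q2_relations v t ->
    exists f : starHom q2_alg B,
      [/\ f q2_u = v, f q2_s2 = t &
          forall g : starHom q2_alg B, g q2_u = v -> g q2_s2 = t -> g =1 f]
}.
Arguments q2_u {R q}.
Arguments q2_s2 {R q}.
Arguments q2_universal {R} q {B v t}.

Section Q2.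
Context {R : realType} {Q : Q2Alg R}.
Implicit Types U V : Q.
Local Notation u := (@q2_u R Q).

Definition q2_s1 : Q := u * q2_s2.
Local Notation s1 := q2_s1.
Local Notation s2 := (@q2_s2 R Q).

Definition q2_W U : Q := s1 * s2^† + s2 * U * s1^†.

Definition S_Q2 : set (Q * Q) :=
  [set UV | [/\ unitary UV.1, unitary UV.2 & UV.1 * UV.2 = UV.2 * q2_W UV.1]].

Lemma S_Q2_relations U V : S_Q2 (U, V) -> Q2_relations U (V * s2).
Proof.
move=> [/= uU [VV VV'] UV].
have [[uu _] ss _ sum1] := @q2_rel R Q.
have orth : s2^† * s1 = 0 := Q2_relations_orth (@q2_rel R Q).
have orth' : s1^† * s2 = 0 by rewrite -[LHS]starK starM starK orth star0.
have ss1 : s1^† * s1 = 1.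
  by rewrite /q2_s1 starM -mulrA (mulrA u^†) uu mul1r.
have Us2 : U * (V * s2) = V * s1.
  by rewrite mulrA UV -mulrA mulrDl -!mulrA ss orth' !mulr0 addr0 mulr1.
have Us1 : U * (V * s1) = V * s2 * U.
  by rewrite mulrA UV -mulrA mulrDl -!mulrA orth ss1 !mulr0 add0r mulr1.
split=> //; first by rewrite /isometry /= starM -mulrA (mulrA V^†) VV mul1r.
  by rewrite expr2 -!mulrA Us2 Us1 mulrA.
have sum1' : s2 * s2^† + s1 * s1^† = 1 by rewrite /q2_s1 starM !mulrA.
rewrite -(mulrA (U * _)) -starM Us2.
have VX (x : Q) : V * x * (V * x)^† = V * (x * x^†) * V^†.
  by rewrite starM !mulrA.
by rewrite !VX -mulrDl -mulrDr sum1' mulr1.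
Qed.

Lemma lambda_exists U V : S_Q2 (U, V) ->
  exists f : starHom Q Q, [/\ f u = U, f s1 = V * s1 & f s2 = V * s2].
Proof.
move=> UV; have [_ _ /= UVW] := UV.
have [f [fu fs2 _]] := q2_universal Q (S_Q2_relations UV).
exists f; split=> //.
have [_ ss _ _] := @q2_rel R Q.
have orth' : s1^† * s2 = 0.
  by rewrite -[LHS]starK starM starK (Q2_relations_orth (@q2_rel R Q)) star0.
have -> : f s1 = f u * f s2 := rmorphM f u s2.
rewrite fu fs2 mulrA UVW -mulrA mulrDl -!mulrA ss orth'.
by rewrite !mulr0 addr0 mulr1.
Qed.

Definition lambda U V (UV : S_Q2 (U, V)) : starHom Q Q :=
  projT1 (cid (lambda_exists UV)).

Lemma lambdaE U V (UV : S_Q2 (U, V)) :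
  [/\ lambda UV u = U, lambda UV s1 = V * s1 & lambda UV s2 = V * s2].
Proof. exact: projT2 (cid (lambda_exists UV)). Qed.

Lemma lambda_unique U V (UV : S_Q2 (U, V)) (f : starHom Q Q) :
  f u = U -> f s2 = V * s2 -> f =1 lambda UV.
Proof.
move=> fu fs2 x; have [lu _ ls2] := lambdaE UV.
have [g [_ _ gP]] := q2_universal Q (S_Q2_relations UV).
exact: etrans (gP f fu fs2 x) (esym (gP (lambda UV) lu ls2 x)).
Qed.

End Q2.

(* Main.v *)
Require Import Defs.
From HB Require Import structures.
From mathcomp Require Import all_boot all_order all_algebra.
From mathcomp Require Import complex.
From mathcomp Require Import boolp classical_sets reals topology normedtype.

Set Implicit Arguments.
Unset Strict Implicit.
Unset Printing Implicit Defensive.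

Import Order.TTheory GRing.Theory Num.Theory.
Import numFieldNormedType.Exports.

Local Open Scope classical_set_scope.
Local Open Scope ring_scope.

(** If [f u = U], then [V' := f(s1) s1^† + f(s2) s2^†] is the unitary with
    [f(s_i) = V' s_i], and [U V' = V' W_U].  Since also [U V = V W_U], both [V]
    and [V'] conjugate [W_U] to [U], so [X := V' V^†] is a unitary commuting
    with [U], and [V' = X V]. *)

Section CStar.
Context {R : realType} {A : cstarAlgType R}.
Implicit Types x y z : A.

Lemma cnormN x : cnorm (- x) = cnorm x.
Proof.
by rewrite -scaleN1r cnormZ /Normc.normc /= oppr0 expr0n addr0 sqrrN expr1n
  sqrtr1 mul1r.
Qed.

(** Since each [a n] commutes with [x], the commutator of [l] and [x] equals
    [x * (a n - l) - (a n - l) * x]. Its norm is thus at most [2 * cnorm x * cnorm (a n - l)], which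
    tends to 0. *)
Lemma norm_closed_commutant1 x : norm_closed (commutant [set x]).
Proof.
move=> a l ax al y -> {y}; apply/eqP; rewrite -subr_eq0; apply/eqP.
apply: cnorm0_eq0; apply/eqP; rewrite eq_le cnorm_ge0 andbT.
have bound n :
    cnorm (l * x - x * l) <= cnorm (a n - l) * (cnorm x + cnorm x).
  have -> : l * x - x * l = x * (a n - l) - (a n - l) * x.
    by rewrite mulrBr mulrBl (ax n x erefl) opprB [RHS]addrC addrA addrNK.
  rewrite [leRHS]mulrDr (le_trans (cnormD _ _)) // cnormN lerD ?cnormM //.
  by rewrite mulrC cnormM.
have lim0 : cnorm (a n - l) * (cnorm x + cnorm x) @[n --> \oo] --> (0 : R).
  by rewrite -[X in _ --> X](mul0r (cnorm x + cnorm x)); apply: cvgMl.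
by apply: (cvgr_to_ge lim0); apply: nearW.
Qed.

(** Taking adjoints turns commutation with [x] into commutation with [x^†], so intersecting the two
    commutants gives closure under [star]. *)
Lemma cstar_subalgebra_commutant x :
  cstar_subalgebra (commutant [set x] `&` commutant [set x^†]).
Proof.
split.
- split; first by split=> _ ->; rewrite mulr0 mul0r.
  by move=> y z [yx yx'] [zx zx']; split=> _ ->;
    rewrite mulrDl mulrDr ?(yx x) ?(zx x) ?(yx' x^†) ?(zx' x^†).
- by move=> c y [yx yx']; split=> _ ->;
    rewrite -scalerAl -scalerAr ?(yx x) ?(yx' x^†).
- move=> y z [yx yx'] [zx zx']; split=> _ ->.
    by rewrite -mulrA (zx x) // mulrA (yx x) // mulrA.
  by rewrite -mulrA (zx' x^†) // mulrA (yx' x^†) // mulrA.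
- move=> y [yx yx']; split=> _ ->; last by rewrite -!starM (yx x).
  by rewrite -[x]starK -!starM (yx' x^†).
- by move=> a l ax al; split; apply: norm_closed_commutant1 al => n;
    have [] := ax n.
Qed.

Lemma unitary_star x : unitary x -> unitary x^†.
Proof. by move=> [xx xx']; split; rewrite starK. Qed.

Lemma unitaryM x y : unitary x -> unitary y -> unitary (x * y).
Proof.
move=> [xx xx'] [yy yy']; split; rewrite starM.
  by rewrite mulrA -(mulrA y^†) xx mulr1.
by rewrite mulrA -(mulrA x) yy' mulr1.
Qed.

(** The elements commuting with both [x] and [x^†] form a C*-subalgebra. It suffices that it
    contains [y], for then it contains all that [y] generates. *)
Lemma unitary_commutant_generated x y : unitary x -> x * y = y * x ->
  commutant (cstar_generated [set y]) x.
Proof.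
move=> [xx xx'] xy z /(_ _ (cstar_subalgebra_commutant x)) [].
  move=> _ ->; split=> _ -> //.
  (* Unitarity yields commutation with the adjoint: [y x^† = x^† x y x^† = x^† y x x^† = x^† y]. *)
  by rewrite -[LHS]mul1r -xx -!mulrA (mulrA x) xy -mulrA xx' mulr1.
by move=> /(_ x erefl).
Qed.

(** The relations of the Cuntz algebra O_2. *)
Definition cuntz2 x y : Prop :=
  [/\ x^† * x = 1, y^† * y = 1, x^† * y = 0, y^† * x = 0 &
      x * x^† + y * y^† = 1].

Lemma cuntz2_isometry t1 t2 s1 s2 : cuntz2 t1 t2 -> cuntz2 s1 s2 ->
  Defs.isometry (t1 * s1^† + t2 * s2^†).
Proof.
move=> [t11 t22 t12 t21 _] [_ _ _ _ s_sum].
have E a b c d : (a * b^†)^† * (c * d^†) = b * (a^† * c) * d^† :> A.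
  by rewrite starM starK !mulrA.
rewrite /Defs.isometry /= starD mulrDl !mulrDr !E t11 t22 t12 t21.
by rewrite !mulr1 !mulr0 !mul0r addr0 add0r.
Qed.

(** The adjoint of the sum has the same form with the two pairs exchanged, so [cuntz2_isometry]
    applies to both. *)
Lemma cuntz2_unitary t1 t2 s1 s2 : cuntz2 t1 t2 -> cuntz2 s1 s2 ->
  unitary (t1 * s1^† + t2 * s2^†).
Proof.
move=> ts ss; split; first exact: cuntz2_isometry.
by have := cuntz2_isometry ss ts; rewrite /Defs.isometry /= !starD !starM !starK.
Qed.

End CStar.

Lemma starHom_cuntz2 (R : realType) (A B : cstarAlgType R) (f : starHom A B)
  (x y : A) : cuntz2 x y -> cuntz2 (f x) (f y).
Proof.
move=> [xx yy xy yx sum1].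
by split; rewrite -!star_hom -!rmorphM -?rmorphD ?xx ?yy ?xy ?yx ?sum1
  ?rmorph0 ?rmorph1.
Qed.

Section Q2.
Context {R : realType} {Q : Q2Alg R}.
Local Notation u := (@q2_u R Q).
Local Notation s1 := (@q2_s1 R Q).
Local Notation s2 := (@q2_s2 R Q).

Lemma q2_cuntz2 : cuntz2 s1 s2.
Proof.
have [[uu _] ss _ sum1] := @q2_rel R Q.
have orth : s2^† * s1 = 0 := Q2_relations_orth (@q2_rel R Q).
split=> //.
- by rewrite /q2_s1 starM -mulrA (mulrA u^†) uu mul1r.
- by rewrite -[LHS]starK starM starK orth star0.
- by rewrite addrC /q2_s1 starM !mulrA.
Qed.

Lemma starHom_S_Q2 (f : starHom Q Q) :
  exists2 V : Q, S_Q2 (f u, V) & f s2 = V * s2.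
Proof.
have C := q2_cuntz2; have [s11 s22 s12 s21 _] := C.
have [[uu uu'] _ su _] := @q2_rel R Q.
pose V := f s1 * s1^† + f s2 * s2^†.
have Vs1 : V * s1 = f s1 by rewrite mulrDl -!mulrA s11 s21 mulr0 addr0 mulr1.
have Vs2 : V * s2 = f s2 by rewrite mulrDl -!mulrA s12 s22 mulr0 add0r mulr1.
exists V => //; split=> /=.
- by split; rewrite -star_hom -rmorphM ?uu ?uu' rmorph1.
- exact: cuntz2_unitary (starHom_cuntz2 f C) C.
(* Both sides of [U V = V W_U], with [U = f u], expand to [f s1 * s2^† + f s2 * f u * s1^†]: the
   left one by the images of [u s2 = s1] and [u s1 = s2 u], the right one by [V s_i = f s_i]. *)
have us2 : f u * f s2 = f s1 by rewrite -rmorphM.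
have us1 : f u * f s1 = f s2 * f u by rewrite -!rmorphM su expr2 -mulrA.
rewrite /q2_W [RHS]mulrDr (mulrA V s1) Vs1 -(mulrA s2) (mulrA V s2) Vs2.
by rewrite /V mulrDr (mulrA _ (f s1)) us1 (mulrA _ (f s2)) us2 addrC mulrA.
Qed.

Lemma S_Q2_commute (U V V' : Q) : S_Q2 (U, V) -> S_Q2 (U, V') ->
  V' * V^† * U = U * (V' * V^†).
Proof.
move=> [/= _ [VV VV'] UV] [/= _ _ UV'].
rewrite [RHS]mulrA UV' -!mulrA; congr (_ * _).
(* Inserting [V V^†] on the right of [V^† U] exposes [U V = V W_U], whence [V^† U = W_U V^†]. *)
by rewrite -[LHS]mulr1 -VV' -mulrA (mulrA U) UV !mulrA VV mul1r.
Qed.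

End Q2.

Theorem theorem1p1 (R : realType) (Q : Q2Alg R) (U V : Q)
    (UV : S_Q2 (U, V)) (f : starHom Q Q) :
  f q2_u = U <->
  exists X : Q, [/\ unitary X, commutant (cstar_generated [set U]) X &
    exists UXV : S_Q2 (U, X * V), f =1 lambda UXV].
Proof.
split=> [fu|[X [_ _ [UXV ->]]]]; last by have [] := lambdaE UXV.
have [V' UV' fs2] := starHom_S_Q2 f; rewrite fu in UV'.
have [/= _ uV _] := UV; have [/= _ uV' _] := UV'.
have uX := unitaryM uV' (unitary_star uV).
exists (V' * V^†); split=> //.
  exact: unitary_commutant_generated uX (S_Q2_commute UV UV').
(* As [X V = V'], the pair [(U, X V)] is the one read off from [f], and uniqueness of the
   endomorphism with these values concludes. *)
have -> : V' * V^† * V = V' by have [VV _] := uV; rewrite -mulrA VV mulr1.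
by exists UV'; apply: lambda_unique.
Qed.
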